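(* Let $G$ be a finite group. Any $G$-Galois extension $\psi:R\to S$ is a Frobenius extension. As a Frobenius system one may choose $((x_i,y_i)_{i=1,\dots,m},\mathrm{tr})$, where $(x_1,\dots,x_m;y_1,\dots,y_m)$ is a Galois basis of $\psi$ and $\mathrm{tr}:S\to R$ is the trace morphism. As a Frobenius element one may take the Galois element $\eta_e=\sum_{i=1}^mx_i\otimes y_i\in S\otimes_RS$.
   Context: Fix a commutative ring $k$; ''algebra'' means associative unital $k$-algebra. If a finite group $G$ acts by ring automorphisms on an algebra $S$, let $S(G)$ be the algebra of all maps $G\to S$ with pointwise operations, a free left $S$-module with basis the Dirac functions $\delta_g$ ($g\in G$). A $G$-Galois extension is a morphism of algebras $\psi:R\to S$ together with a finite group $G$ acting by ring automorphisms on $S$, trivially on $\psi(R)$, such that $S$ is faithfully flat as a left $R$-module and $\Gamma:S\otimes_RS\to S(G)$, $\Gamma(s\otimes t)=\sum_{g\in G}s\,g(t)\,\delta_g$, is an isomorphism. For such an extension it is known that $\psi$ is injective with image $S^G$, so $R$ is identified with $S^G$; the trace $\mathrm{tr}:S\to R$ is the $R$-bimodule morphism $\mathrm{tr}(s)=\sum_{g\in G}g(s)$. The Galois element is $\eta_e=\Gamma^{-1}(\delta_e)$ ($e$ the neutral element); a Galois basis is a tuple $(x_1,\dots,x_m;y_1,\dots,y_m)$ of elements of $S$ with $\eta_e=\sum_ix_i\otimes y_i$. A morphism of algebras $\psi:R\to S$ is a Frobenius extension if there are an $R$-bimodule morphism $\tau:S\to R$ and finitely many pairs $(u_i,v_i)_{i=1,\dots,m}$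 in $S\times S$ with $\sum_iu_i\tau(v_is)=s=\sum_i\tau(su_i)v_i$ for all $s\in S$. Then $((u_i,v_i)_i,\tau)$ is called a Frobenius system and $\sum_iu_i\otimes v_i\in S\otimes_RS$ the Frobenius element. *)

(* Defs.v *)
From HB Require Import structures.
From mathcomp Require Import all_boot all_fingroup all_algebra.
From mathcomp Require Import generic_quotient ring_quotient boolp freeg.

Set Implicit Arguments.
Unset Strict Implicit.
Unset Printing Implicit Defensive.

Import GRing.Theory.

Local Open Scope ring_scope.

(* The library's [algType] only covers nonzero rings.  So as not to exclude   *)
(* the zero algebra, an associative unital k-algebra is given here by its     *)
(* ring and its structure map a |-> a *: 1, a ring morphism with central      *)
(* image.                                                                     *)
Record algebra (k : comPzRingType) := Algebra {
  alg_ring :> pzRingType;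
  alg_map : {rmorphism k -> alg_ring};
  alg_map_central : forall (a : k) (x : alg_ring),
    alg_map a * x = x * alg_map a
}.

Fact algType_central (k : comNzRingType) (A : algType k) (a : k) (x : A) :
  in_alg A a * x = x * in_alg A a.
Proof. by rewrite /= -scalerAl mul1r -scalerAr mulr1. Qed.

Definition algebra_of_algType (k : comNzRingType) (A : algType k) : algebra k :=
  Algebra (@algType_central k A).

Definition algebra_morphism (k : comPzRingType) (R S : algebra k)
    (psi : {rmorphism R -> S}) : Prop :=
  forall a : k, psi (alg_map R a) = alg_map S a.

Section Tensor.

(* Right R-modules are left modules over the converse ring: [(r : R^c) *: m]  *)
(* stands for m r.                                                            *)
Variables (R : pzRingType) (M : lmodType R^c) (N : lmodType R).

Local Notation pretensor := {freeg (M * N)%type / int}.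
Local Notation gen m n := (<<((m, n) : M * N)>> : pretensor).

Inductive tensor_null : pretensor -> Prop :=
| TensorNull0 : tensor_null 0
| TensorNullB x y : tensor_null x -> tensor_null y -> tensor_null (x - y)
| TensorNullDl m1 m2 n :
    tensor_null (gen (m1 + m2) n - (gen m1 n + gen m2 n))
| TensorNullDr m n1 n2 :
    tensor_null (gen m (n1 + n2) - (gen m n1 + gen m n2))
| TensorNullZ m (r : R) n :
    tensor_null (gen ((r : R^c) *: m) n - gen m (r *: n)).

Definition tensor_rel : {pred pretensor} := fun x => `[< tensor_null x >].

Fact tensor_rel_zmod_closed : zmod_closed tensor_rel.
Proof.
split; first exact/asboolP/TensorNull0.
by move=> x y /asboolP nx /asboolP ny; apply/asboolP/TensorNullB.
Qed.

HB.instance Definition _ :=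
  GRing.isZmodClosed.Build pretensor tensor_rel tensor_rel_zmod_closed.

Definition tensor : Type := Quotient.quot tensor_rel.

HB.instance Definition _ := GRing.Zmodule.on tensor.

Definition tensor_pi : pretensor -> tensor := \pi_(Quotient.quot tensor_rel)%qT.

HB.instance Definition _ := GRing.Additive.on tensor_pi.

Definition tens (m : M) (n : N) : tensor := tensor_pi (gen m n).

Definition balanced (A : zmodType) (f : M -> N -> A) : Prop :=
  [/\ forall m1 m2 n, f (m1 + m2) n = f m1 n + f m2 n,
      forall m n1 n2, f m (n1 + n2) = f m n1 + f m n2
    & forall m (r : R) n, f ((r : R^c) *: m) n = f m (r *: n)].

Lemma tensor_pi_eq x y : tensor_pi x = tensor_pi y <-> tensor_null (x - y).
Proof.
have E := Quotient.idealrBE tensor_rel x y.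
split=> [/eqP exy|nxy]; first by apply/asboolP; move: exy; rewrite -E.
by apply/eqP; rewrite -E; apply/asboolP.
Qed.

Lemma tens_balanced : balanced tens.
Proof.
rewrite /tens; split=> *; rewrite -?raddfD; apply/tensor_pi_eq; by constructor.
Qed.

Section Lift.

Variables (A : zmodType) (f : M -> N -> A).

Definition pretensor_lift : pretensor -> A :=
  fglift (fun p : M * N => f p.1 p.2 : zmodule A).

HB.instance Definition _ := GRing.isZmodMorphism.Build pretensor A
  pretensor_lift (lift_is_additive (M := zmodule A) _).

(* The map m (x) n |-> f m n.  It is only meaningful when [f] is balanced,    *)
(* see [tensor_lift_tens] and [tensor_lift_zmod_morphism].                    *)
Definition tensor_lift (t : tensor) : A :=
  pretensor_lift (repr (t : Quotient.quot tensor_rel)).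

Hypothesis f_bal : balanced f.

Let pretensor_liftU m n : pretensor_lift (gen m n) = f m n.
Proof. by rewrite /pretensor_lift liftU scale1r. Qed.

Lemma pretensor_lift_null x : tensor_null x -> pretensor_lift x = 0.
Proof.
case: f_bal => fDl fDr fZ; elim=> [|{}x y _ Fx _ Fy|m1 m2 n|m n1 n2|m r n].
- exact: raddf0.
- by rewrite raddfB /= Fx Fy subrr.
- by rewrite raddfB raddfD /= !pretensor_liftU fDl subrr.
- by rewrite raddfB raddfD /= !pretensor_liftU fDr subrr.
- by rewrite raddfB /= !pretensor_liftU fZ subrr.
Qed.

Lemma tensor_lift_pi x : tensor_lift (tensor_pi x) = pretensor_lift x.
Proof.
apply/eqP; rewrite -subr_eq0 /tensor_lift -raddfB; apply/eqP.
by apply/pretensor_lift_null/tensor_pi_eq; rewrite [LHS]reprK.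
Qed.

Lemma tensor_lift_tens m n : tensor_lift (tens m n) = f m n.
Proof. by rewrite tensor_lift_pi pretensor_liftU. Qed.

Lemma tensor_lift_zmod_morphism : zmod_morphism tensor_lift.
Proof.
have piK t : tensor_pi (repr (t : Quotient.quot tensor_rel)) = t := reprK t.
move=> t u; rewrite -(piK t) -(piK u) -raddfB !tensor_lift_pi; exact: raddfB.
Qed.

End Lift.

End Tensor.

(* (f (x) N) : A (x) N -> B (x) N.                                            *)
Definition tensor_map (R : pzRingType) (A B : lmodType R^c) (N : lmodType R)
    (f : A -> B) : tensor A N -> tensor B N :=
  tensor_lift (fun a n => tens (f a) n).

Definition exact_at (A B C : zmodType) (f : A -> B) (g : B -> C) : Prop :=
  forall b : B, g b = 0 <-> exists a : A, f a = b.

Definition faithfully_flat (R : pzRingType) (N : lmodType R) : Prop :=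
  forall (A B C : lmodType R^c) (f : {linear A -> B}) (g : {linear B -> C}),
    exact_at f g <-> exact_at (tensor_map (N := N) f) (tensor_map (N := N) g).

Section RestrictionOfScalars.

Variables (R S : pzRingType) (psi : {rmorphism R -> S}).

Definition left_restr of {rmorphism R -> S} : Type := S.
Definition right_restr of {rmorphism R -> S} : Type := S.

HB.instance Definition _ := GRing.Zmodule.on (left_restr psi).
HB.instance Definition _ := GRing.Zmodule.on (right_restr psi).

Definition left_restr_scale (r : R) (s : left_restr psi) : left_restr psi :=
  psi r * (s : S).
Definition right_restr_scale (r : R^c) (s : right_restr psi) :
  right_restr psi := (s : S) * psi r.

Fact left_restr_scaleA a b s :
  left_restr_scale a (left_restr_scale b s) = left_restr_scale (a * b) s.
Proof. by rewrite /left_restr_scale rmorphM mulrA. Qed.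
Fact left_restr_scale1 : left_id 1 left_restr_scale.
Proof. by move=> s; rewrite /left_restr_scale rmorph1 mul1r. Qed.
Fact left_restr_scaleDr : right_distributive left_restr_scale +%R.
Proof. by move=> a s t; exact: mulrDr. Qed.
Fact left_restr_scaleDl s : {morph left_restr_scale^~ s : a b / a + b}.
Proof. by move=> a b; rewrite /left_restr_scale rmorphD; exact: mulrDl. Qed.

HB.instance Definition _ := GRing.Zmodule_isLmodule.Build R (left_restr psi)
  left_restr_scaleA left_restr_scale1 left_restr_scaleDr left_restr_scaleDl.

Fact right_restr_scaleA (a b : R^c) s :
  right_restr_scale a (right_restr_scale b s) = right_restr_scale (a * b) s.
Proof. by rewrite /right_restr_scale -mulrA -rmorphM. Qed.
Fact right_restr_scale1 : left_id 1 right_restr_scale.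
Proof. by move=> s; rewrite /right_restr_scale rmorph1 mulr1. Qed.
Fact right_restr_scaleDr : right_distributive right_restr_scale +%R.
Proof. by move=> a s t; exact: mulrDl. Qed.
Fact right_restr_scaleDl s : {morph right_restr_scale^~ s : a b / a + b}.
Proof. by move=> a b; rewrite /right_restr_scale rmorphD; exact: mulrDr. Qed.

HB.instance Definition _ := GRing.Zmodule_isLmodule.Build R^c (right_restr psi)
  right_restr_scaleA right_restr_scale1
  right_restr_scaleDr right_restr_scaleDl.

Definition tensor_sq : Type := tensor (right_restr psi) (left_restr psi).

Definition tens_sq (s t : S) : tensor_sq :=
  tens (s : right_restr psi) (t : left_restr psi).

Definition bimodule_morphism (tau : S -> R) : Prop :=
  [/\ zmod_morphism tau,
      forall r s, tau (psi r * s) = r * tau s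
    & forall s r, tau (s * psi r) = tau s * r].

Definition frobenius_system (m : nat) (u v : 'I_m -> S) (tau : S -> R) : Prop :=
  bimodule_morphism tau /\
  forall s : S, \sum_i u i * psi (tau (v i * s)) = s /\
                \sum_i psi (tau (s * u i)) * v i = s.

Definition frobenius_extension : Prop :=
  exists (m : nat) (u v : 'I_m -> S) (tau : S -> R), frobenius_system u v tau.

(* [eta] is the Frobenius element of a Frobenius system with morphism [tau].  *)
Definition frobenius_element (tau : S -> R) (eta : tensor_sq) : Prop :=
  exists (m : nat) (u v : 'I_m -> S),
    frobenius_system u v tau /\ eta = \sum_i tens_sq (u i) (v i).

End RestrictionOfScalars.

(* Actions of G on S by ring automorphisms, trivial on the image of psi.      *)
(* Bijectivity of each [act g] follows from the group action axioms.          *)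
Record galois_action (G : finGroupType) (R S : pzRingType)
    (psi : {rmorphism R -> S}) := GaloisAction {
  gact :> G -> {rmorphism S -> S};
  gact1 : forall s, gact 1%g s = s;
  gactM : forall g h s, gact (g * h)%g s = gact g (gact h s);
  gact_base : forall g r, gact g (psi r) = psi r
}.

Section Galois.

Variables (G : finGroupType) (R S : pzRingType) (psi : {rmorphism R -> S}).
Variable act : galois_action G psi.

(* S(G), as a left S-module.                                                  *)
Local Notation SG := {ffun G -> S^o}.

Definition dirac (g : G) : SG := [ffun h => (h == g)%:R].

Definition gamma_fun (s : right_restr psi) (t : left_restr psi) : SG :=
  \sum_(g : G) ((s : S) * act g t) *: dirac g.

Definition Gamma : tensor_sq psi -> SG := tensor_lift gamma_fun.

Lemma gamma_fun_balanced : balanced gamma_fun.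
Proof.
rewrite /gamma_fun; split=> [s1 s2 t|s t1 t2|s r t].
- by rewrite -big_split; apply: eq_bigr => g _; rewrite mulrDl scalerDl.
- rewrite -big_split /=; apply: eq_bigr => g _.
  by rewrite -scalerDl -mulrDr -rmorphD.
- apply: eq_bigr => g _; congr (_ *: _).
  by rewrite [RHS]/= rmorphM /= gact_base mulrA.
Qed.

Lemma Gamma_tens s t :
  Gamma (tens_sq psi s t) = \sum_(g : G) (s * act g t) *: dirac g.
Proof. exact/tensor_lift_tens/gamma_fun_balanced. Qed.

Definition galois_extension : Prop :=
  faithfully_flat (left_restr psi) /\ bijective Gamma.

(* [tr] is the trace morphism, R being embedded in S by [psi].                *)
Definition galois_trace (tr : S -> R) : Prop :=
  forall s : S, psi (tr s) = \sum_(g : G) act g s.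

(* [eta] is the inverse image of delta_e under Gamma.                         *)
Definition galois_element (eta : tensor_sq psi) : Prop := Gamma eta = dirac 1%g.

Definition galois_basis (m : nat) (x y : 'I_m -> S) : Prop :=
  galois_element (\sum_i tens_sq psi (x i) (y i)).

End Galois.

(* Main.v *)
Require Import Defs.
From HB Require Import structures.
From mathcomp Require Import all_boot all_fingroup all_algebra.
From mathcomp Require Import generic_quotient boolp freeg.

(** Read through Gamma, the equation for a Galois basis says that
      [sum_i x_i g(y_i) = delta_(g,1)]   for all g in G,
    and applying g to its instance at [g^-1] turns it into the mirror identity
      [sum_i g(x_i) y_i = delta_(g,1)].
    Expanding tr as a sum over G, both Frobenius identities collapse to the
    term g = 1:
      [sum_i x_i tr(y_i s) = sum_g (sum_i x_i g(y_i)) g(s) = s],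
      [sum_i tr(s x_i) y_i = sum_g g(s) (sum_i g(x_i) y_i) = s].
    This is [galois_basis_frobenius].  A Galois basis exists because every
    element of a tensor product is a finite sum of pure tensors
    ([tensor_sumE]), the integer coefficients being absorbed in the left
    factor.

    What remains is that tr takes its values in R, and is a bimodule morphism
    to R: one needs psi to be injective with image the ring of invariants
    [S^G].  Both come from faithfully flat descent: the sequence
      [0 -> R -> S -> S(G)],   with maps psi and s |-> (g(s) - s)_g,
    is exact because it becomes exact after tensoring with S over R.
    - The map psi (x) S has the left inverse [s (x) t |-> 1 (x) s t], hence
      is injective ([psi_inj]).
    - Let t in S (x) S be killed by the second map, and let c be the product
      of its two factors, that is, the value of Gamma t at 1.  Evaluating at
      g and multiplying by g of the right factor gives [g(c) = Gamma(t)(g)];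
      the left side is [Gamma(1 (x) c)(g)], so [t = 1 (x) c] by injectivity
      of Gamma ([fixed_in_base]). *)

Set Implicit Arguments.
Unset Strict Implicit.
Unset Printing Implicit Defensive.

Import GRing.Theory.

Local Open Scope ring_scope.

(** * Elements of a tensor product and additive maps out of it *)

Lemma zmod_morphism_semi (U V : zmodType) (f : U -> V) :
  zmod_morphism f -> f 0 = 0 /\ {morph f : x y / x + y}.
Proof.
move=> fB; have f0 : f 0 = 0 by rewrite -[X in f X](subrr 0) fB subrr.
by split=> // x y; rewrite -[y in LHS]opprK -[- y]sub0r !fB f0 sub0r opprK.
Qed.

Section TensorElements.

Variables (R : pzRingType) (M : lmodType R^c) (N : lmodType R).

(** A tensor is an integral combination of pure tensors; the coefficients
    disappear because [c (m (x) n) = (c m) (x) n] for an integer c. *)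
Lemma tensor_sumE (t : tensor M N) :
  exists (m : nat) (u : 'I_m -> M) (v : 'I_m -> N),
    t = \sum_i tens (u i) (v i).
Proof.
have [D <-] : exists D, tensor_pi D = t.
  by exists (repr (t : Quotient.quot (@tensor_rel R M N))); exact: reprK.
pose z (i : 'I_(size (dom D))) := tnth (in_tuple (dom D)) i.
exists (size (dom D)), (fun i => (z i).1 *~ coeff (z i) D), (fun i => (z i).2).
rewrite -[D in LHS]freeg_sumE big_tnth raddf_sum; apply: eq_bigr => i _ /=.
rewrite -/(z i); case: (z i) => m n /=; set c := coeff _ _.
rewrite -[c in LHS]intz -freegU_mulz raddfMz -/(tens m n).
have [tDl _ _] := tens_balanced M N.
have tB : zmod_morphism (fun m0 : M => tens m0 n).
  by move=> m1 m2; apply/eqP; rewrite eq_sym subr_eq -tDl subrK.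
pose F : {additive M -> tensor M N} :=
  HB.pack (fun m0 : M => tens m0 n) (GRing.isZmodMorphism.Build _ _ _ tB).
exact: esym (raddfMz F c m).
Qed.

Lemma tensor_ext (A : zmodType) (f g : tensor M N -> A) :
    zmod_morphism f -> zmod_morphism g ->
    (forall m n, f (tens m n) = g (tens m n)) -> f =1 g.
Proof.
move=> /zmod_morphism_semi[f0 fD] /zmod_morphism_semi[g0 gD] fg t.
have [m [u [v ->]]] := tensor_sumE t.
elim/big_ind: _ => [|x y Ex Ey|i _]; first by rewrite f0.
  by rewrite fD gD Ex Ey.
exact: fg.
Qed.

End TensorElements.

Section TensorMap.

Variables (R : pzRingType) (N : lmodType R).

Lemma tensor_map_balanced (A B : lmodType R^c) (f : {linear A -> B}) :
  balanced (fun (a : A) (n : N) => tens (f a) n).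
Proof.
have [tDl tDr tZ] := tens_balanced B N.
by split=> *; rewrite ?raddfD ?linearZ /= ?tDl ?tDr ?tZ.
Qed.

Lemma tensor_map_tens (A B : lmodType R^c) (f : {linear A -> B}) a n :
  tensor_map f (tens a n : tensor A N) = tens (f a) n.
Proof. exact: tensor_lift_tens (tensor_map_balanced f) _ _. Qed.

Lemma tensor_map_zmod_morphism (A B : lmodType R^c) (f : {linear A -> B}) :
  zmod_morphism (tensor_map (N := N) f).
Proof. exact: tensor_lift_zmod_morphism (tensor_map_balanced f). Qed.

Lemma tens0l (A : lmodType R^c) (n : N) : tens (0 : A) n = 0.
Proof.
have [tDl _ _] := tens_balanced A N.
by apply: (addrI (tens 0 n)); rewrite -tDl !addr0.
Qed.

Lemma tensor_map0 (A B : lmodType R^c) (f : {linear A -> B}) :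
  (forall a, f a = 0) -> forall t, tensor_map (N := N) f t = 0.
Proof.
move=> f0; apply: tensor_ext => [||a n]; first exact: tensor_map_zmod_morphism.
  by move=> x y; rewrite subr0.
by rewrite tensor_map_tens f0 tens0l.
Qed.

Lemma tensor_map_comp0 (A B C : lmodType R^c)
    (f : {linear A -> B}) (g : {linear B -> C}) :
  (forall a, g (f a) = 0) ->
  forall t, tensor_map (N := N) g (tensor_map f t) = 0.
Proof.
move=> gf0; apply: tensor_ext => [x y|x y|a n]; last first.
- by rewrite !tensor_map_tens gf0 tens0l.
- by rewrite subr0.
- by rewrite !tensor_map_zmod_morphism.
Qed.

End TensorMap.

(** * Descent: R is the ring of invariants of S *)

Section Descent.

Variables (G : finGroupType) (R S : pzRingType) (psi : {rmorphism R -> S}).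
Variable act : galois_action G psi.

Lemma Gamma_zmod_morphism : zmod_morphism (Gamma act).
Proof. exact: tensor_lift_zmod_morphism (gamma_fun_balanced act). Qed.

Lemma Gamma_tensE s t g : Gamma act (tens_sq psi s t) g = s * act g t.
Proof.
rewrite Gamma_tens sum_ffunE (bigD1 g) //= big1 ?addr0 => [|h neq_hg].
  by rewrite !ffunE eqxx; exact: mulr1.
by rewrite !ffunE eq_sym (negPf neq_hg); exact: mulr0.
Qed.

Lemma Gamma_sumE m (u v : 'I_m -> S) g :
  Gamma act (\sum_i tens_sq psi (u i) (v i)) g = \sum_i u i * act g (v i).
Proof.
have [G0 GD] := zmod_morphism_semi Gamma_zmod_morphism.
rewrite (big_morph (fun t => Gamma act t g) (id1 := 0) (op1 := +%R)).
- by apply: eq_bigr => i _; rewrite Gamma_tensE.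
- by move=> x y; rewrite GD ffunE.
- by rewrite G0 ffunE.
Qed.

(** The map psi as a morphism of right R-modules.  The source has to be the
    regular module of the converse ring, since right modules are encoded as
    left modules over it. *)
Definition base_map : (R^c)^o -> right_restr psi := psi.

Fact base_map_linear : linear base_map.
Proof.
move=> a x y; rewrite /base_map.
by rewrite rmorphD; congr (_ + _); exact: (rmorphM psi x a).
Qed.

HB.instance Definition _ := GRing.isLinear.Build R^c (R^c)^o (right_restr psi)
  _ base_map base_map_linear.

(** Its kernel is the set of invariants, and it is right R-linear since G
    fixes the image of psi. *)
Definition coboundary (s : right_restr psi) : {ffun G -> right_restr psi} :=
  [ffun g => (act g s : right_restr psi) - s].

Fact coboundary_linear : linear coboundary.
Proof.
move=> a x y; apply/ffunP => g; rewrite !ffunE.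
rewrite rmorphD [act g (a *: x)](rmorphM _ (x : S)) gact_base.
rewrite scalerBr opprD addrACA; congr (_ + _).
Qed.

HB.instance Definition _ := GRing.isLinear.Build R^c (right_restr psi)
  {ffun G -> right_restr psi} _ coboundary coboundary_linear.

Hypothesis S_ff : faithfully_flat (left_restr psi).

(** Flatness reflects exactness of [R -> R -> S], with maps 0 and psi; after
    tensoring, psi is split by multiplication [s (x) t |-> 1 (x) s t]. *)
Lemma psi_inj : injective psi.
Proof.
pose z : {linear (R^c)^o -> (R^c)^o} := \0.
pose L (s : right_restr psi) (t : left_restr psi) :=
  tens (1 : (R^c)^o) ((s * t : S) : left_restr psi).
have Lbal : balanced L.
  have [_ tDr _] := tens_balanced (R^c)^o (left_restr psi).
  split=> *; rewrite /L -?tDr; congr (tens _ _).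
  - exact: mulrDl.
  - exact: mulrDr.
  - exact/esym/mulrA.
have LK : cancel (tensor_map base_map) (tensor_lift L).
  apply: tensor_ext => // [|r s].
    move=> x y; rewrite tensor_map_zmod_morphism.
    by rewrite (tensor_lift_zmod_morphism Lbal).
  rewrite tensor_map_tens (tensor_lift_tens Lbal).
  have [_ _ tZ] := tens_balanced (R^c)^o (left_restr psi).
  rewrite -[LHS]tZ; congr (tens _ _).
  exact: (mulr1 (r : R^c)).
have exact_t : exact_at (tensor_map (N := left_restr psi) z)
                        (tensor_map base_map).
  move=> t; split=> [t0|[u <-]]; last first.
    by apply: tensor_map_comp0 => a; exact: rmorph0.
  exists 0; rewrite tensor_map0 // -[t]LK t0.
  by case: (zmod_morphism_semi (tensor_lift_zmod_morphism Lbal)).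
have exact_psi := (S_ff z (base_map : {linear _ -> _})).2 exact_t.
move=> a b eq_ab; apply/eqP; rewrite -subr_eq0; apply/eqP.
have [|c <- //] := (exact_psi (a - b)).1.
by rewrite raddfB; apply/eqP; rewrite subr_eq0; apply/eqP.
Qed.

Hypothesis Gamma_bij : bijective (Gamma act).

(** Flatness reduces this to exactness of [R (x) S -> S (x) S -> S(G) (x) S]
    at the middle term.  There the invariance of a tensor t can be tested
    after applying Gamma, which forces [t = 1 (x) c] with c the product of
    the two factors of t. *)
Lemma fixed_in_base (s : S) : (forall g, act g s = s) -> exists r, psi r = s.
Proof.
have exact_t : exact_at (tensor_map (N := left_restr psi) base_map)
                        (tensor_map coboundary).
  move=> t; split=> [t0|[u <-]]; last first.
    apply: tensor_map_comp0 => a; apply/ffunP => g.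
    by rewrite !ffunE gact_base subrr.
  (* E g : f (x) b |-> f(g) g(b) extracts from the image of t the equation
     g(c) = Gamma(t)(g), where c = mu t. *)
  pose E g (f : {ffun G -> right_restr psi}) (b : left_restr psi) : S :=
    f g * act g b.
  have Ebal g : balanced (E g).
    rewrite /E; split=> *; rewrite ?ffunE ?rmorphD ?mulrDl ?mulrDr //.
    rewrite [X in _ = _ * X](rmorphM (act g)) gact_base mulrA //.
  (* Gamma(a (x) b)(1) = a b, so mu is the multiplication of S. *)
  pose mu : tensor_sq psi -> S := fun t => Gamma act t 1%g.
  have muB : zmod_morphism mu.
    by move=> x y; rewrite /mu Gamma_zmod_morphism !ffunE.
  have Et g (u : tensor_sq psi) :
      tensor_lift (E g) (tensor_map coboundary u) =
      act g (mu u) - Gamma act u g.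
    move: u; apply: tensor_ext => [x y|x y|a b].
    - by rewrite tensor_map_zmod_morphism (tensor_lift_zmod_morphism (Ebal g)).
    - rewrite muB Gamma_zmod_morphism !ffunE rmorphB /= !opprD.
      by rewrite addrACA.
    - rewrite tensor_map_tens (tensor_lift_tens (Ebal g)) /mu.
      rewrite -/(tens_sq psi a b) !Gamma_tensE.
      have -> : act 1%g b = b by exact: Defs.gact1.
      have -> : E g (coboundary a) b = (act g a - a) * act g b.
        by rewrite /E /coboundary ffunE.
      rewrite rmorphM; exact: mulrBl.
  exists (tens (1 : (R^c)^o) (mu t : left_restr psi)).
  rewrite tensor_map_tens; apply: (bij_inj Gamma_bij); apply/ffunP => g.
  rewrite -[X in Gamma _ X]/(tens_sq psi (psi 1) (mu t)) Gamma_tensE.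
  rewrite rmorph1 mul1r; apply/eqP; rewrite -subr_eq0 -Et t0; apply/eqP.
  by case: (zmod_morphism_semi (tensor_lift_zmod_morphism (Ebal g))).
move=> s_fix.
have [|r <-] := ((S_ff (base_map : {linear _ -> _}) coboundary).2 exact_t s).1.
  by apply/ffunP => g; rewrite !ffunE s_fix subrr.
by exists r.
Qed.

Lemma act_sum g s : act g (\sum_h act h s) = \sum_h act h s.
Proof.
rewrite rmorph_sum [RHS](reindex_inj (mulgI g)) /=.
by apply: eq_bigr => h _; rewrite Defs.gactM.
Qed.

Lemma galois_trace_exists : exists tr : S -> R, galois_trace act tr.
Proof.
have /choice[tr trE] : forall s, exists r, psi r = \sum_g act g s.
  by move=> s; apply: fixed_in_base => g; exact: act_sum.
by exists tr.
Qed.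

End Descent.

(** * The trace and a Galois basis form a Frobenius system *)

Section Frobenius.

Variables (G : finGroupType) (R S : pzRingType) (psi : {rmorphism R -> S}).
Variable act : galois_action G psi.

(** Injectivity of psi lets the identities be checked in S, where each g is
    multiplicative and fixes the image of psi. *)
Lemma galois_trace_bimodule (tr : S -> R) :
  injective psi -> galois_trace act tr -> bimodule_morphism psi tr.
Proof.
move=> psiI trE; split=> [s t|r s|s r]; apply: psiI.
- by rewrite rmorphB !trE -sumrB; apply: eq_bigr => g _; rewrite rmorphB.
- rewrite rmorphM !trE mulr_sumr; apply: eq_bigr => g _.
  by rewrite rmorphM gact_base.
- rewrite rmorphM !trE mulr_suml; apply: eq_bigr => g _.
  by rewrite rmorphM gact_base.
Qed.

Variables (m : nat) (x y : 'I_m -> S).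
Hypothesis xy_basis : galois_basis act x y.

Lemma galois_basis_sum g : \sum_i x i * act g (y i) = (g == 1%g)%:R.
Proof. by rewrite -Gamma_sumE xy_basis ffunE. Qed.

(** The image under g of the previous identity at [g^-1]. *)
Lemma galois_basis_sumV g : \sum_i act g (x i) * y i = (g == 1%g)%:R.
Proof.
have := congr1 (act g) (galois_basis_sum g^-1%g).
rewrite rmorph_sum rmorph_nat eq_invg1 => <-.
by apply: eq_bigr => i _; rewrite rmorphM -Defs.gactM mulgV Defs.gact1.
Qed.

Lemma sum_delta (F : G -> S) : \sum_g (g == 1%g)%:R * F g = F 1%g.
Proof.
rewrite (bigD1 1%g) //= eqxx mul1r big1 ?addr0 // => g /negPf->.
exact: mul0r.
Qed.

(** Exchanging the sums over i and over g leaves one of the two orthogonality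
    relations as inner sum, so that only the term g = 1 survives. *)
Lemma galois_basis_frobenius (tr : S -> R) :
  injective psi -> galois_trace act tr -> frobenius_system psi x y tr.
Proof.
move=> psiI trE; split=> [|s]; first exact: galois_trace_bimodule.
split.
- transitivity (\sum_g (\sum_i x i * act g (y i)) * act g s).
    under eq_bigr do rewrite trE mulr_sumr.
    rewrite exchange_big; apply: eq_bigr => g _; rewrite mulr_suml.
    by apply: eq_bigr => i _; rewrite rmorphM mulrA.
  by under eq_bigr do rewrite galois_basis_sum; rewrite sum_delta Defs.gact1.
- transitivity (\sum_g act g s * (\sum_i act g (x i) * y i)).
    under eq_bigr do rewrite trE mulr_suml.
    rewrite exchange_big; apply: eq_bigr => g _; rewrite mulr_sumr.
    by apply: eq_bigr => i _; rewrite rmorphM mulrA.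
  under eq_bigr do rewrite galois_basis_sumV mulr_natr -mulr_natl.
  by rewrite sum_delta Defs.gact1.
Qed.

End Frobenius.

Theorem lemma2p5 (k : comPzRingType) (G : finGroupType) (R S : algebra k)
    (psi : {rmorphism R -> S}) (psi_k : algebra_morphism psi)
    (act : galois_action G psi) (galois : galois_extension act) :
  [/\ frobenius_extension psi,
      exists (m : nat) (x y : 'I_m -> S), galois_basis act x y,
      exists tr : S -> R, galois_trace act tr
    & forall tr : S -> R, galois_trace act tr ->
        (forall (m : nat) (x y : 'I_m -> S), galois_basis act x y ->
           frobenius_system psi x y tr) /\
        (forall eta : tensor_sq psi, galois_element act eta ->
           frobenius_element tr eta)].
Proof.
have [S_ff Gamma_bij] := galois; have psiI := psi_inj S_ff.
have [tr trE] := galois_trace_exists S_ff Gamma_bij.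
have [m [x [y xy]]] : exists (m : nat) (x y : 'I_m -> S), galois_basis act x y.
  have [Gamma_inv _ Gamma_invK] := Gamma_bij.
  have [m [x [y def_eta]]] := tensor_sumE (Gamma_inv (dirac S 1%g)).
  by exists m, x, y; rewrite /galois_basis -[\sum_i _]def_eta; exact: Gamma_invK.
split; [|by exists m, x, y|by exists tr|].
  by exists m, x, y, tr; exact: (galois_basis_frobenius xy psiI trE).
move=> {m x y xy}tr' tr'E; split=> [m x y xy|eta eta1].
  exact: (galois_basis_frobenius xy psiI tr'E).
have [m [x [y def_eta]]] := tensor_sumE eta.
exists m, x, y; split=> //; apply: galois_basis_frobenius => //.
by rewrite /galois_basis -[\sum_i _]def_eta.
Qed.
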